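(* Let $$T(x)=\#\{(n,m)\in\mathbb{N}^2 : |e^n+(\sqrt5)^n-7^m-\pi^m|\leq x\}.$$ Then $$\frac{(\log x)^2}{\log 7}+O(\log x)\leq T(x)\leq\frac{(\log x)^2}{\log 7}+O(\log x\cdot\log\log x).$$
   Context: $\mathbb{N}$ denotes the positive integers; $e$ is Euler's number. The $O$-terms refer to $x\to\infty$, with absolute constants. *)

(* Defs.v *)
(* MathComp-Analysis, over an arbitrary [R : realType]. *)
From mathcomp Require Export all_boot all_order all_algebra.
From mathcomp Require Export finmap.
From mathcomp Require Export all_classical all_reals all_analysis.
Export Order.TTheory GRing.Theory Num.Theory.
Export numFieldNormedType.Exports.

Set Implicit Arguments.
Unset Strict Implicit.
Unset Printing Implicit Defensive.

Local Open Scope classical_set_scope.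
Local Open Scope ring_scope.

Definition close_pairs (R : realType) (x : R) : set (nat * nat) :=
  [set p | [/\ (0 < p.1)%N, (0 < p.2)%N &
     `| expR 1 ^+ p.1 + Num.sqrt 5 ^+ p.1 - 7 ^+ p.2 - pi ^+ p.2 | <= x]].

(* [fset_set A] is empty when [A] is infinite, so this is the number of close
   pairs only when [close_pairs x] is finite. *)
Definition T (R : realType) (x : R) : nat := #|` fset_set (close_pairs x)|%fset.

(* The Landau notation [f =O_F g] needs a canonical [filter_on] for F. *)
Canonical pinfty_filter_on (R : numFieldType) : filter_on R :=
  FilterType (pinfty_nbhs R) _.

(* Main.v *)
Require Import Defs.
From mathcomp Require Import ring lra zify.

(* The pairs with [7^m <= 4x] fill, up to [O(log x)], a box with sides [log x] and
   [log x / log 7]. If [7^m > 4x] then [m] determines [n], because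
   [e^n + sqrt 5 ^ n] at least doubles with [n]; so it suffices that [m = O(log x)] for
   every close pair. As [sqrt 5 ^ n] and [pi^m] are at most the 9/10-th power of
   [X = max(7^m, e^n)], this follows from [|7^m - e^n| >= c X e^(-m/20)], a very weak
   irrationality measure of [log 7].

   The latter comes from Hermite-Padé approximation of [1, e^z, e^(2z)]: there are
   integers [A_j] of size [exp(O(q log (q m)))] such that [A_0 + A_1 e^z + A_2 e^(2z)] is
   at most [64 (216 m / q^2)^q] at [z = n/m], hence tiny once [q^2] exceeds a multiple
   of [m]. If [A_0 + 7 A_1 + 49 A_2] is nonzero, [e^z] cannot be too close to 7. Taking
   [q] a power of 7, the Frobenius map makes [A_0] explicit mod 7 and shows that this
   integer does not vanish. *)

Set Implicit Arguments.
Unset Strict Implicit.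
Unset Printing Implicit Defensive.

Local Open Scope classical_set_scope.
Local Open Scope ring_scope.

(** * Exponential polynomials *)

(* [egf 0 s z] is the sum of [s_i (2z)^i / i!]. The factor 2 keeps coefficients
   integral when [D + d] is inverted for [d] = 1, -1, 2, -2; the offset [k] makes
   differentiation a decrement. *)
Fixpoint egf {R : realType} k (s : seq int) (z : R) : R :=
  if s is a :: t then a%:~R * ((2 * z) ^+ k / k`!%:R) + egf k.+1 t z else 0.

(* On these coefficients [D] is twice the left shift; for [e * d = 2] this is
   the solution of [(D + d) y = 2 s], see [egf_shift_solve]. *)
Fixpoint shift_solve (e : int) (s : seq int) : seq int :=
  if s is a :: t then e * (a - head 0 (shift_solve e t)) :: shift_solve e t else [::].

(* The weight 6 serves twice: it exceeds 4, so that [shift_solve e] with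
   [|e| <= 2] is bounded, and it dominates [2 z] for [z <= 3]. *)
Fixpoint weighted_norm (s : seq int) : int := if s is a :: t then `|a| + 6 * weighted_norm t else 0.

Lemma size_shift_solve e s : size (shift_solve e s) = size s.
Proof. by elim: s => //= a t ->. Qed.

Lemma weighted_norm_ge0 s : 0 <= weighted_norm s.
Proof. elim: s => //= a t; lia. Qed.

Lemma weighted_norm_head s : `|head 0 s| <= weighted_norm s.
Proof. by case: s => //= a t; have := weighted_norm_ge0 t; lia. Qed.

(** The head joins the left side to carry the induction: the new head counts twice, costing at most
    [4 |a| + 4 |head r|], and 6 times the inductive hypothesis absorbs the second term. The head
    also bounds the constants [c] chosen later. *)
Lemma weighted_norm_shift_solve e s : `|e| <= 2 ->
  weighted_norm (shift_solve e s) + `|head 0 (shift_solve e s)| <= 4 * weighted_norm s.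
Proof.
move=> e2; elim: s => //= a t IH; set r := shift_solve e t in IH *.
have : `|e * (a - head 0 r)| <= 2 * (`|a| + `|head 0 r|).
  rewrite normrM (le_trans (ler_wpM2r _ e2))// ler_pM2l//; exact: ler_normB.
move: IH; set b := (X in `|X| <= _); rewrite -/b; clearbody b.
by move: (weighted_norm r) (weighted_norm t) (head 0 r) => u v h; lia.
Qed.

Lemma egf0 (R : realType) (s : seq int) : egf 0 s (0 : R) = (head 0 s)%:~R.
Proof.
have evS k t : egf k.+1 t (0 : R) = 0.
  by elim: t k => //= a t IH k; rewrite IH mulr0 expr0n/= mul0r mulr0 addr0.
by case: s => //= a t; rewrite evS expr0 divr1 mulr1 addr0.
Qed.

(** Coefficientwise: the recursion [b = e (a - head r)] gives [d b + 2 head r = 2 a]. *)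
Lemma egf_shift_solve (R : realType) (e d : int) (s : seq int) k (z : R) : e * d = 2 ->
  d%:~R * egf k (shift_solve e s) z + 2 * egf k (behead (shift_solve e s)) z = 2 * egf k s z.
Proof.
move=> ed; elim: s k => [|a t IH] k /=; first by rewrite !mulr0 addr0.
set r := shift_solve e t in IH *; set w : R := (2 * z) ^+ k / k`!%:R.
have -> : egf k r z = (head 0 r)%:~R * w + egf k.+1 (behead r) z.
  by case: (r) => //=; rewrite mul0r addr0.
rewrite [RHS]mulrDr -IH intrM.
have : e%:~R * d%:~R = 2 :> R by rewrite -intrM ed.
rewrite intrB; move: w (e%:~R) (d%:~R) (egf k.+1 r z) (egf k.+1 (behead r) z) => w E D u v ED.
ring: ED.
Qed.

Lemma is_derive_egf (R : realType) k s (z : R) : is_derive z 1 (egf k.+1 s) (2 * egf k s z).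
Proof.
elim: s k => [|a t IH] k /=.
  by rewrite mulr0; exact: is_derive_cst.
rewrite mulrDr.
rewrite [X in is_derive _ _ X _](_ : _ =
  (a%:~R / k.+1`!%:R) *: ((2 \*: (id : R -> R)) ^+ k.+1) + egf k.+2 t); last first.
  apply/funext => y /=; rewrite !fctE/= /GRing.scale/=. ring.
apply: is_deriveD (IH _).
apply: is_derive_eq.
rewrite /= ?fctE/= /GRing.scale/= mulr1 factS natrM; field.
by rewrite nat1r !pnatr_eq0 -lt0n fact_gt0.
Qed.

Lemma is_derive_expRZ (R : realType) (j t : R) : is_derive t 1 (fun x => expR (j * x)) (j * expR (j * t)).
Proof.
rewrite mulrC; apply: (@is_derive1_comp _ expR (fun x => j * x)).
rewrite -[X in is_derive _ _ _ X]mulr1.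
exact: (@is_deriveZ _ _ _ id j).
Qed.

Lemma is_derive_egf_cons (R : realType) (c : int) s (t : R) :
  is_derive t 1 (egf 0 (c :: s)) (2 * egf 0 s t).
Proof.
rewrite (_ : egf 0 (c :: s) = cst (c%:~R : R) + egf 1 s); last first.
  by apply/funext => x; rewrite /= expr0 divr1 mulr1.
have := is_deriveD (is_derive_cst (c%:~R : R) t 1) (is_derive_egf 0 s t).
by rewrite add0r.
Qed.

(** Here [l] is the node being raised and [j] the exponent of the term. For [j <> l] the equation
    [y' - l y = 2 f] has a solution of the same shape, with a polynomial no longer than before. *)
Lemma is_derive_egf_shift_solve_exp (R : realType) (s : seq int) (e d : int) (l j t : R) :
  e * d = 2 -> j - l = d%:~R ->
  is_derive t 1 (fun x => egf 0 (shift_solve e s) x * expR (j * x))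
    (l * (egf 0 (shift_solve e s) t * expR (j * t)) + 2 * (egf 0 s t * expR (j * t))).
Proof.
move=> ed jl.
have dE : is_derive t 1 (egf 0 (shift_solve e s) : R -> R) (2 * egf 0 (behead (shift_solve e s)) t).
  case: (shift_solve e s) => [|b r]; last exact: is_derive_egf_cons.
  by rewrite mulr0; exact: is_derive_cst.
apply: (is_derive_eq (is_deriveM dE (is_derive_expRZ j t))).
have := egf_shift_solve s 0 t ed; rewrite -jl /GRing.scale/=.
move: (egf 0 _ _) (egf 0 _ _) (egf 0 _ _) (expR _) => u v w E H.
rewrite [2 * (u * E)]mulrA -H; ring.
Qed.

(** The resonant case [j = l]: solving is plain integration, which lengthens the list and leaves the
    constant [c] free. *)
Lemma is_derive_egf_cons_exp (R : realType) (s : seq int) (c : int) (l t : R) :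
  is_derive t 1 (fun x => egf 0 (c :: s) x * expR (l * x))
    (l * (egf 0 (c :: s) t * expR (l * t)) + 2 * (egf 0 s t * expR (l * t))).
Proof.
apply: (is_derive_eq (is_deriveM (is_derive_egf_cons c s t) (is_derive_expRZ l t))).
by rewrite /GRing.scale/=; ring.
Qed.

Lemma ge0_of_derive (R : realType) (w dw : R -> R) (t : R) :
  (forall x : R, is_derive x 1 w (dw x)) -> w 0 = 0 ->
  (forall x, 0 <= x -> 0 <= dw x) -> 0 <= t -> 0 <= w t.
Proof.
move=> dwE w0 dw0 t0.
have [|c c0 E] := MVT_segment t0 (fun x _ => dwE x).
  by apply: continuous_subspaceT => x; apply/differentiable_continuous/derivable1_diffP; case: (dwE x).
rewrite w0 !subr0 in E; rewrite E mulr_ge0// dw0//.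
by move: c0; rewrite in_itv/= => /andP[].
Qed.

(** After multiplication by the integrating factor [exp(- l t)], bound minus [g] becomes [w], whose
    derivative is nonnegative by the bound on [f] and [l <= 2]. *)
Lemma growth_step_le (R : realType) (l B : R) (f g : R -> R) (s : nat) : l <= 2 ->
  (forall t : R, is_derive t 1 g (l * g t + 2 * f t)) -> g 0 = 0 -> 0 <= B ->
  (forall t : R, 0 <= t -> f t <= B * (t ^+ s / s`!%:R) * expR (2 * t)) ->
  forall t : R, 0 <= t -> g t <= 2 * B * (t ^+ s.+1 / s.+1`!%:R) * expR (2 * t).
Proof.
move=> l2 dg g0 B0 hf t t0.
pose p x : R := 2 * B * (x ^+ s.+1 / s.+1`!%:R).
have dp (x : R) : is_derive x 1 p (2 * B * (x ^+ s / s`!%:R)).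
  rewrite [p](_ : _ = (2 * B / s.+1`!%:R) *: (id ^+ s.+1)); last first.
    by apply/funext => y /=; rewrite /p !fctE/= /GRing.scale/=; ring.
  apply: is_derive_eq.
  rewrite /GRing.scale/= mulr1 factS natrM; field.
  by rewrite nat1r !pnatr_eq0 -lt0n fact_gt0.
pose w x := p x * expR ((2 - l) * x) - g x * expR (- l * x).
suff : 0 <= w t.
  rewrite /w subr_ge0 => /(ler_wpM2r (expR_ge0 (l * t))).
  rewrite -!mulrA -!expRD mulNr addNr expR0 mulr1.
  by rewrite (_ : (2 - l) * t + l * t = 2 * t)// -mulrDl subrK.
have dw (x : R) := is_deriveB (is_deriveM (dp x) (is_derive_expRZ (2 - l) x))
   (is_deriveM (dg x) (is_derive_expRZ (- l) x)).
apply: (ge0_of_derive dw) => //.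
  by rewrite /= !fctE g0 /p expr0n/=; ring.
move=> x x0 /=; rewrite /GRing.scale/=.
have E : expR ((2 - l) * x) = expR (2 * x) * expR (- l * x) by rewrite -expRD -mulrDl.
have p0 : 0 <= p x by rewrite /p !mulr_ge0// ?invr_ge0 ?exprn_ge0.
have := hf _ x0 => /(ler_wpM2r (expR_ge0 (- l * x))).
rewrite -[X in _ <= X]mulrA -E.
have : 0 <= (2 - l) * (p x * expR ((2 - l) * x)) 
  by apply: mulr_ge0; [rewrite subr_ge0|rewrite mulr_ge0 ?expR_ge0].
move: (p x) (expR _) (expR (- l * x)) (f x) (g x) => P E1 E2 F G.
lra.
Qed.

Lemma growth_step (R : realType) (l B : R) (f g : R -> R) (s : nat) : l <= 2 ->
  (forall t : R, is_derive t 1 g (l * g t + 2 * f t)) -> g 0 = 0 ->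
  (forall t : R, 0 <= t -> `|f t| <= B * (t ^+ s / s`!%:R) * expR (2 * t)) ->
  forall t : R, 0 <= t -> `|g t| <= 2 * B * (t ^+ s.+1 / s.+1`!%:R) * expR (2 * t).
Proof.
move=> l2 dg g0 hf.
have B0 : 0 <= B.
  have := le_trans (normr_ge0 _) (hf 1 ler01); rewrite expr1n div1r.
  by rewrite pmulr_lge0 ?expR_gt0// pmulr_lge0// invr_gt0 ltr0n fact_gt0.
move=> t t0; rewrite ler_norml lerNl; apply/andP; split.
- apply: (@growth_step_le _ l B (\- f) (\- g)) => //=.
  + move=> x; apply: (is_derive_eq (is_deriveN (dg x))) => /=.
    by rewrite opprD !mulrN.
  + by rewrite g0 oppr0.
  + by move=> x /hf; rewrite ler_norml lerNl => /andP[].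
- by apply: (@growth_step_le _ l B f g) => // x /hf; rewrite ler_norml => /andP[].
Qed.

(** * The Hermite-Padé form *)

Definition exp_form {R : realType} (s0 s1 s2 : seq int) (t : R) : R :=
  egf 0 s0 t * expR (0 * t) + egf 0 s1 t * expR (1 * t) + egf 0 s2 t * expR (2 * t).

(** [B] controls the integer coefficients; [C] quantifies the vanishing to order [N] at 0. The
    factor [expR (2 * t)] survives each integration because no node exceeds 2. *)
Definition hermite_bound (R : realType) (s0 s1 s2 : seq int) (B : int) (C : R) (N : nat) :=
  weighted_norm s0 + weighted_norm s1 + weighted_norm s2 <= B /\
  forall t : R, 0 <= t -> `|exp_form s0 s1 s2 t| <= C * (t ^+ N / N`!%:R) * expR (2 * t).

Lemma exp_form0 (R : realType) s0 s1 s2 :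
  exp_form s0 s1 s2 (0 : R) = (head 0 s0 + head 0 s1 + head 0 s2)%:~R.
Proof. by rewrite /exp_form !egf0 !mulr0 expR0 !mulr1 !intrD. Qed.

(* Each step replaces the form [F] by the solution [G] of [G' - l G = 2 F] with
   [G(0) = 0], raising the multiplicity of the node [l] (here 1, then 2) and
   the order of vanishing at 0. *)
Lemma hermite_bound_step1 (R : realType) s0 s1 s2 B (C : R) N :
  hermite_bound s0 s1 s2 B C N ->
  exists c, hermite_bound (shift_solve (-2) s0) (c :: s1) (shift_solve 2 s2) (8 * B) (2 * C) N.+1.
Proof.
move=> [hB hC]; pose c := - (head 0 (shift_solve (-2) s0) + head 0 (shift_solve 2 s2)); exists c; split.
  (* [|c|] is at most the sum of the two heads, which [weighted_norm_shift_solve] already counts;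
     the three norms contribute with factors 4, 6, 4, all below 8. *)
  have /= := @weighted_norm_shift_solve (-2) s0 isT; have /= := @weighted_norm_shift_solve 2 s2 isT.
  have := weighted_norm_ge0 s1; have := weighted_norm_ge0 s0; have := weighted_norm_ge0 s2.
  move: hB (weighted_norm_head s0) (ler_normD (head 0 (shift_solve (-2) s0)) (head 0 (shift_solve 2 s2))).
  rewrite /c /= normrN; lia.
apply: (@growth_step R 1 C (exp_form s0 s1 s2)
  (exp_form (shift_solve (-2) s0) (c :: s1) (shift_solve 2 s2)) N) => //.
- by lra.
- move=> t; apply: (is_derive_eq (is_deriveD (is_deriveD
    (@is_derive_egf_shift_solve_exp R s0 (-2) (-1) 1 0 t _ _)
    (@is_derive_egf_cons_exp R s1 c 1 t))
    (@is_derive_egf_shift_solve_exp R s2 2 1 1 2 t _ _))) => //.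
  + by rewrite sub0r.
  + by lra.
  + by rewrite /exp_form; ring.
- rewrite exp_form0; apply/eqP; rewrite intr_eq0; apply/eqP => /=.
  by move: (head 0 (shift_solve (-2) s0)) (head 0 (shift_solve 2 s2)) @c => u v c; rewrite /c; ring.
Qed.

Lemma hermite_bound_step2 (R : realType) s0 s1 s2 B (C : R) N :
  hermite_bound s0 s1 s2 B C N ->
  exists c, hermite_bound (shift_solve (-1) s0) (shift_solve (-2) s1) (c :: s2) (8 * B) (2 * C) N.+1.
Proof.
move=> [hB hC]; pose c := - (head 0 (shift_solve (-1) s0) + head 0 (shift_solve (-2) s1)); exists c; split.
  have /= := @weighted_norm_shift_solve (-1) s0 isT; have /= := @weighted_norm_shift_solve (-2) s1 isT.
  have := weighted_norm_ge0 s1; have := weighted_norm_ge0 s0; have := weighted_norm_ge0 s2.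
  move: hB (weighted_norm_head s0) (ler_normD (head 0 (shift_solve (-1) s0)) (head 0 (shift_solve (-2) s1))).
  rewrite /c /= normrN; lia.
apply: (@growth_step R 2 C (exp_form s0 s1 s2)
  (exp_form (shift_solve (-1) s0) (shift_solve (-2) s1) (c :: s2)) N) => //.
- move=> t; apply: (is_derive_eq (is_deriveD (is_deriveD
    (@is_derive_egf_shift_solve_exp R s0 (-1) (-2) 2 0 t _ _)
    (@is_derive_egf_shift_solve_exp R s1 (-2) (-1) 2 1 t _ _))
    (@is_derive_egf_cons_exp R s2 c 2 t))) => //.
  + by rewrite sub0r.
  + by lra.
  + by rewrite /exp_form; ring.
- rewrite exp_form0; apply/eqP; rewrite intr_eq0; apply/eqP => /=.
  by move: (head 0 (shift_solve (-1) s0)) (head 0 (shift_solve (-2) s1)) @c => u v c; rewrite /c; ring.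
Qed.

(* Coefficients of [2^(3q) (D - 1)^(-q) (D - 2)^(-q) (z^q / q!)], the polynomial
   factor of [exp(0 z)] in the form. *)
Definition hermite0 q := iter q (shift_solve (-1)) (iter q (shift_solve (-2)) (rcons (nseq q 0) 1)).

(** Start from [(2 z)^q / q!], which vanishes to order [q], then apply [q] steps at node 1 and [q]
    steps at node 2. The constants are [384 = 6 * 8 * 8] and [8 = 2 * 2 * 2]. *)
Lemma hermite_bound_exists (R : realType) (q : nat) :
  exists s1 s2, [/\ size s1 = q, size s2 = q &
    @hermite_bound R (hermite0 q) s1 s2 (384 ^+ q) (8 ^+ q) (3 * q)].
Proof.
have init : @hermite_bound R (rcons (nseq q 0) 1) [::] [::] (6 ^+ q) (2 ^+ q) q.
  split.
    rewrite !addr0; elim: (q) => //= k IH; rewrite exprS; lia.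
  move=> t t0; rewrite /exp_form /= !mul0r !addr0 expR0 mulr1.
  have -> : egf 0 (rcons (nseq q 0) 1) t = 2 ^+ q * (t ^+ q / q`!%:R).
    rewrite mulrA -exprMn -[q in RHS]add0n.
    suff H k j : egf j (rcons (nseq k 0) 1) t = (2 * t) ^+ (j + k) / (j + k)`!%:R by exact: H.
    elim: k j => [|k IH] j /=; first by rewrite addr0 mul1r addn0.
    by rewrite mul0r add0r IH addSnnS.
  rewrite ger0_norm ?mulr_ge0 ?exprn_ge0 ?invr_ge0//.
  rewrite ler_peMr ?mulr_ge0 ?exprn_ge0 ?invr_ge0//.
  by rewrite (le_trans _ (expR_ge1Dx _))// lerDl mulr_ge0.
have phase1 i : exists2 s1, size s1 = i &
    @hermite_bound R (iter i (shift_solve (-2)) (rcons (nseq q 0) 1)) s1 [::]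
      (8 ^+ i * 6 ^+ q) (2 ^+ i * 2 ^+ q) (i + q).
  elim: i => [|i [s1 <- /hermite_bound_step1[c H]]]; first by exists [::]; rewrite ?mul1r.
  by exists (c :: s1); rewrite // !exprS -!mulrA addSn.
have phase2 i : exists s1 s2, [/\ size s1 = q, size s2 = i &
    @hermite_bound R (iter i (shift_solve (-1)) (iter q (shift_solve (-2)) (rcons (nseq q 0) 1))) s1 s2
      (8 ^+ i * (8 ^+ q * 6 ^+ q)) (2 ^+ i * (2 ^+ q * 2 ^+ q)) (i + (q + q))].
  elim: i => [|i [s1 [s2 [sz1 sz2 /hermite_bound_step2[c H]]]]].
    have [s1 sz1 H] := phase1 q; exists s1, [::]; split => //.
    by rewrite !mul1r.
  exists (shift_solve (-2) s1), (c :: s2); split; rewrite ?size_shift_solve//= ?sz2//.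
  by rewrite !exprS -!mulrA addSn.
have [s1 [s2 [sz1 sz2 H]]] := phase2 q; exists s1, s2; split => //.
rewrite (_ : 3 * q = q + (q + q))%N; last by lia.
move: H; rewrite -!exprMn.
have -> : 8 * (8 * 6) = 384 :> int by lia.
by have -> : 2 * (2 * 2) = 8 :> R by lra.
Qed.

(** * Non-vanishing modulo powers of 7 *)

(** Reversal turns the left shift into multiplication by ['X], so that [shift_solve e] becomes, up
    to a factor [e], division by [1 + e X] modulo [X^(size s)]. *)
Fixpoint revpoly (s : seq int) : {poly 'F_7} :=
  if s is a :: t then revpoly t + a%:~R *: 'X^(size t) else 0.

Lemma size_revpoly s : (size (revpoly s) <= size s)%N.
Proof.
elim: s => [|a t IH] /=; first by rewrite size_poly0.
rewrite (leq_trans (size_polyD _ _))// geq_max (leq_trans IH)//=.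
by rewrite (leq_trans (size_scale_leq _ _))// size_polyXn.
Qed.

Lemma coef_revpoly s i : (i < size s)%N ->
  (revpoly s)`_(size s - i.+1) = (s`_i)%:~R.
Proof.
elim: s i => [|a t IH] [|i] //= si; rewrite coefD coefZ coefXn.
  by rewrite subSS subn0 eqxx mulr1 nth_default ?add0r// size_revpoly.
by rewrite subSS IH// ltn_eqF ?mulr0 ?addr0// ltn_subrL /=; case: (size t) si.
Qed.

(** The extra term comes from the head, which the left shift drops and multiplication by ['X]
    keeps. *)
Lemma revpoly_shift_solve e s : (1 + e%:~R *: 'X) * revpoly (shift_solve e s) =
  e%:~R *: revpoly s + (e%:~R * (head 0 (shift_solve e s))%:~R) *: 'X^(size s).
Proof.
elim: s => [|a t IH] /=; first by rewrite mulr0 scaler0 mulr0 scale0r addr0.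
rewrite mulrDr IH size_shift_solve intrM intrB exprS -!mul_polyC !polyCM !polyCB.
by ring.
Qed.

Lemma revpoly_iter_shift_solve e k s : exists r, (1 + e%:~R *: 'X) ^+ k * revpoly (iter k (shift_solve e) s) =
  e%:~R ^+ k *: revpoly s + 'X^(size s) * r.
Proof.
elim: k => [|k [r IH]] /=.
  by exists 0; rewrite !expr0 mul1r scale1r mulr0 addr0.
have szk : size (iter k (shift_solve e) s) = size s by elim: (k) => //= j; rewrite size_shift_solve.
set h := iter k _ s in IH szk *.
exists (e%:~R *: r + (1 + e%:~R *: 'X) ^+ k * (e%:~R * (head 0 (shift_solve e h))%:~R)%:P).
rewrite exprSr -mulrA revpoly_shift_solve mulrDr -scalerAr IH szk.
rewrite exprS -!mul_polyC !polyCM; set E := e%:~R%:P; set H := (head 0 _)%:~R%:P.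
by rewrite rmorphXn /= -/E; ring.
Qed.

Lemma size_hermite0 q : size (hermite0 q) = q.+1.
Proof.
have H e k s : size (iter k (shift_solve e) s) = size s by elim: k => //= j; rewrite size_shift_solve.
by rewrite /hermite0 !H size_rcons size_nseq.
Qed.

(* In characteristic 7 and for [q = 7^k], the reversed polynomial [P] satisfies
   [(1 - X^q) (1 - 2 X^q) P = 2] modulo [X^(q+1)]. *)
Lemma hermite0_mod7 q k : q = (7 ^ k)%N ->
  ((hermite0 q)`_q)%:~R = 2 :> 'F_7 /\ ((hermite0 q)`_0)%:~R = -1 :> 'F_7.
Proof.
move=> qE; have q0 : (0 < q)%N by rewrite qE expn_gt0.
have ch7 : 7 \in [pchar {poly 'F_7}] by rewrite pchar_poly pchar_Fp.
have nat7 : ([pchar {poly 'F_7}]).-nat q by rewrite qE pnatX (pnatE _ (isT : prime 7)) ch7.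
have cq (c : 'F_7) : c ^+ q = c.
  rewrite qE; elim: (k) => [|j IH]; first by rewrite expr1.
  rewrite expnS mulnC exprM IH; apply: val_inj.
  by case: c {IH}; do 7?[case=> //].
have [r1 E1] := revpoly_iter_shift_solve (-2) q (rcons (nseq q 0) 1).
have [r2 E2] := revpoly_iter_shift_solve (-1) q (iter q (shift_solve (-2)) (rcons (nseq q 0) 1)).
have sz : size (iter q (shift_solve (-2)) (rcons (nseq q 0) 1)) = q.+1.
  elim: (q in iter q) => [|j IH] /=; first by rewrite size_rcons size_nseq.
  by rewrite size_shift_solve.
rewrite sz in E2; rewrite size_rcons size_nseq in E1.
have init : revpoly (rcons (nseq q 0) 1) = 1.
  elim: (q) => [|j IH] /=; first by rewrite add0r scale1r.
  by rewrite IH scale0r addr0.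
pose P := revpoly (hermite0 q).
have frob (c : 'F_7) : (1 + c *: 'X) ^+ q = 1 + c *: 'X^q.
  by rewrite exprDn_pchar// expr1n exprZn cq.
(* The constant is [(-1)^q (-2)^q], equal to 2 by Fermat ([cq]); [frob] turns the [q]-th powers into
   binomials. *)
have {E1 E2} [r E] : exists r, (1 - 'X^q) * (1 - 2%:P * 'X^q) * P = 2%:P + 'X^(q.+1) * r.
  exists (- r1 + (1 - 2%:P * 'X^q) * r2).
  move: E1 E2; rewrite init !frob !cq -!mul_polyC -/P mulr1.
  set P1 := revpoly _; rewrite !mulrNz !polyCN !mulr1z.
  rewrite polyC1 => E1 E2.
  have -> : (1 - 'X^q) * (1 - 2%:P * 'X^q) * P = (1 - 2%:P * 'X^q) * ((1 + -1 * 'X^q) * P) by ring.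
  rewrite E2 mulrDr.
  have -> : (1 - 2%:P * 'X^q) * (-1 * P1) = - ((1 + - (2%:~R)%:P * 'X^q) * P1).
    by rewrite -[2%:~R]/(2 : 'F_7) mulN1r mulrN mulNr.
  by rewrite E1 -[2%:~R]/2; ring.
have Pq : P`_q = ((hermite0 q)`_0)%:~R.
  by have := @coef_revpoly (hermite0 q) 0; rewrite size_hermite0 subSS subn0; apply.
have P0 : P`_0 = ((hermite0 q)`_q)%:~R.
  by have := @coef_revpoly (hermite0 q) q; rewrite size_hermite0 subnn; apply.
have XqM (u : {poly 'F_7}) j : ('X^q * u)`_j = if (j < q)%N then 0 else u`_(j - q) by rewrite coefXnM.
(* At degrees 0 and [q] neither the [X^(2q)] nor the [X^(q+1)] term contributes, so [P_0 = 2] and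
   [P_q = 3 P_0 = 6 = -1]. Reversal swaps the indices 0 and [q] of [hermite0 q]. *)
have EE : P - 3%:P * ('X^q * P) + 2%:P * ('X^q * ('X^q * P)) = 2%:P + 'X^(q.+1) * r by rewrite -E; ring.
have c0 : P`_0 = 2.
  have := congr1 (fun p : {poly 'F_7} => p`_0) EE.
  by rewrite !coefD coefN !coefCM !XqM coefXnM coefC q0 /= !mulr0 oppr0 !addr0.
split; first by rewrite -P0.
rewrite -Pq.
have := congr1 (fun p : {poly 'F_7} => p`_q) EE.
rewrite !coefD coefN !coefCM !XqM coefXnM coefC ltnn ltnSn subnn q0 gtn_eqF// c0 mulr0 !addr0.
move/eqP; rewrite subr_eq add0r => /eqP ->.
by apply/eqP.
Qed.

Lemma logn7_fact i : (0 < i)%N -> (logn 7 i`! < i)%N.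
Proof.
move=> i0; rewrite logn_fact//.
(* An invariant for Legendre's sum [S], from [7 * (a %/ 7) <= a]; it gives [6 S <= i], hence
   [S < i]. *)
suff H N : (6 * \sum_(1 <= k < N.+1) i %/ 7 ^ k + i %/ 7 ^ N <= i)%N.
  by have := H i; move: (\sum_(1 <= k < i.+1) _)%N (i %/ _)%N => S r; lia.
elim: N => [|N IH]; first by rewrite big_geq// expn0 divn1.
rewrite big_nat_recr//= expnSr divnMA.
move: IH; move: (i %/ 7 ^ N)%N (\sum_(_ <= _ < _) _)%N => a b; lia.
Qed.

(* [q! m^q egf 0 s (n/m)], an integer; [q ^_ (q - i)] is [q! / i!]. *)
Definition cleared_egf q n m (s : seq int) : int :=
  \sum_(i < size s) s`_i * ((q ^_ (q - i)) * (2 * n) ^ i * m ^ (q - i))%N%:Z.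

Lemma cleared_egfE (R : realType) q n m s : (0 < m)%N -> (size s <= q.+1)%N ->
  (cleared_egf q n m s)%:~R = q`!%:R * m%:R ^+ q * egf 0 s (n%:R / m%:R : R).
Proof.
move=> m0 sq.
have egfE k t z : egf k t z = \sum_(i < size t) (t`_i)%:~R * ((2 * z) ^+ (k + i) / (k + i)`!%:R) :> R.
  elim: t k => [|a t IH] k /=; first by rewrite big_ord0.
  rewrite big_ord_recl IH addn0 /=; congr (_ + _).
  by apply: eq_bigr => i _; rewrite /bump /= add1n addnS addSn.
rewrite egfE /cleared_egf rmorph_sum mulr_sumr; apply: eq_bigr => i _ /=.
have iq : (i <= q)%N by rewrite -ltnS (leq_trans (ltn_ord i)).
rewrite intrM add0n mulrCA; congr (_ * _).
rewrite -pmulrn !natrM !natrX natrM.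
have -> : q`!%:R = (q ^_ (q - i))%:R * i`!%:R :> R.
  by rewrite -natrM -(@ffact_fact q (q - i)) ?leq_subr// subKn.
rewrite -[in m%:R ^+ q](subnK iq) exprD !exprMn exprVn.
have : m%:R != 0 :> R by rewrite pnatr_eq0 -lt0n.
have : i`!%:R != 0 :> R by rewrite pnatr_eq0 -lt0n fact_gt0.
move: (i`!%:R) (m%:R : R) => f M f0 M0; field.
by rewrite f0 expf_neq0.
Qed.

(* If 7 does not divide [n], every term but the one of index [q] of the first
   summand vanishes mod 7. If 7 divides [n], then [n^i q! / i!] has larger 7-adic
   valuation than [q!] for [i > 0], so the terms of index 0 decide. *)
Lemma cleared_form_neq0 q k n m s1 s2 : q = (7 ^ k.+1)%N -> (0 < n)%N -> coprime n m ->
  size s1 = q -> size s2 = q ->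
  cleared_egf q n m (hermite0 q) + 7 * cleared_egf q n m s1 + 49 * cleared_egf q n m s2 != 0.
Proof.
move=> qE n0 co sz1 sz2; have [hq h0] := hermite0_mod7 qE.
have q0 : (0 < q)%N by rewrite qE expn_gt0.
have dvd7q : (7 %| q)%N by rewrite qE expnS dvdn_mulr.
have Fp0 a : (a%:R == 0 :> 'F_7) = (7 %| a)%N.
  by rewrite -(dvdn_pcharf (pchar_Fp (isT : prime 7))).
have [d7n|nd7n] := boolP (7 %| n)%N; last first.
  apply/eqP => /(congr1 (fun x : int => x%:~R : 'F_7)); rewrite !intrD !intrM.
  have -> : 7%:~R = 0 :> 'F_7 by apply/eqP.
  have -> : 49%:~R = 0 :> 'F_7 by apply/eqP.
  rewrite !mul0r !addr0 mulr0z /cleared_egf rmorph_sum size_hermite0 big_ord_recr /= big1 => [|i _].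
    rewrite add0r subnn ffactn0 expn0 mul1n muln1 intrM hq -pmulrn => /eqP.
    rewrite mulf_eq0 (_ : (2 == 0) = false)//= Fp0 Euclid_dvdX// Euclid_dvdM//.
    by rewrite (negPf nd7n).
  rewrite intrM -pmulrn; apply/eqP; rewrite mulf_eq0 Fp0 -mulnA dvdn_mulr ?orbT//.
  have : (0 < q - i)%N by rewrite subn_gt0.
  by case: (q - i)%N => // j _; rewrite ffactnS dvdn_mulr.
have nd7m : ~~ (7 %| m)%N.
  apply/negP => d7m; have : (7 %| gcdn n m)%N by rewrite dvdn_gcd d7n.
  by rewrite (eqP co).
pose v := logn 7 q`!.
have clearedM s : (size s <= q.+1)%N -> exists u : int, cleared_egf q n m s =
    head 0 s * (q`! * m ^ q)%N%:Z + u * (7 ^ v.+1)%N%:Z.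
  case: s => [|a t] sq; first by exists 0; rewrite /cleared_egf big_ord0 !mul0r addr0.
  rewrite /cleared_egf /= big_ord_recl /= subn0 ffactnn expn0 muln1.
  suff /dvdzP[u ->] : ((7 ^ v.+1)%N %| \sum_(i < size t) (a :: t)`_(lift ord0 i) *
      ((q ^_ (q - lift ord0 i)) * (2 * n) ^ (lift ord0 i) * m ^ (q - lift ord0 i))%N%:Z)%Z.
    by exists u.
  apply: rpred_sum => i _; apply: dvdz_mull; rewrite dvdzE !absz_nat; apply: dvdn_mulr.
  have jq : (lift ord0 i <= q)%N by rewrite -ltnS (leq_trans _ sq)//= !ltnS.
  have : (0 < lift ord0 i)%N by [].
  move: (nat_of_ord (lift ord0 i)) jq => j jq j0.
  have f0 : (0 < q ^_ (q - j))%N by rewrite ffact_gt0 leq_subr.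
  rewrite pfactor_dvdn// ?muln_gt0 ?f0 ?expn_gt0 ?muln_gt0 ?n0//.
  rewrite lognM ?expn_gt0 ?muln_gt0 ?n0// lognX lognM//.
  have : (0 < logn 7 n)%N by rewrite logn_gt0 mem_primes n0 d7n.
  have := logn7_fact j0.
  (* The term of index [j] has 7-adic valuation at least [v - v_7(j!) + j], which exceeds [v]. *)
  have : v = (logn 7 (q ^_ (q - j)) + logn 7 j`!)%N.
    by rewrite -lognM ?fact_gt0// /v -(@ffact_fact q (q - j)) ?leq_subr// subKn.
  move: (logn 7 n) (logn 7 2) => x y -> h1 h2.
  have : (j <= j * (y + x))%N by rewrite leq_pmulr// addn_gt0 h2 orbT.
  lia.
have [|u0 ->] := clearedM (hermite0 q); first by rewrite size_hermite0.
have [|u1 ->] := clearedM s1; first by rewrite sz1.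
have [|u2 ->] := clearedM s2; first by rewrite sz2.
have [|w cow wE] := @pfactor_coprime 7 q`! isT; first exact: fact_gt0.
pose W := head 0 (hermite0 q) + 7 * head 0 s1 + 49 * head 0 s2.
apply/eqP => H0.
have : ((7 ^ v.+1)%N %| W * (q`! * m ^ q)%N%:Z)%Z.
  apply/dvdzP; exists (- (u0 + 7 * u1 + 49 * u2)); rewrite /W.
  move: H0; move: (Posz (q`! * m ^ q)) (Posz (7 ^ v.+1)) => x y H0; rewrite mulNr; apply/eqP.
  by rewrite -addr_eq0; apply/eqP; apply: etrans H0; ring.
(* Cancel [7 ^ v]: then 7 divides [W w m^q], while [w] and [m] are prime to 7 and [W = -1] mod 7. *)
rewrite wE -/v expnS [(w * _)%N]mulnC -mulnA !PoszM mulrCA [(Posz 7 * _)]mulrC.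
rewrite dvdz_mul2l ?gt_eqF// => [/dvdzP[u] /(congr1 (fun x : int => x%:~R : 'F_7))|]; last first.
  by rewrite ltz_nat expn_gt0.
have -> : (u * 7)%:~R = 0 :> 'F_7 by rewrite intrM; apply/eqP; rewrite mulf_eq0 orbT.
move/eqP; rewrite !intrM !mulf_eq0 -!pmulrn !Fp0 Euclid_dvdX// (negPf nd7m) andFb orbF.
move: cow; rewrite prime_coprime// => /negPf ->; rewrite orbF /W !intrD !intrM.
have -> : 7%:~R = 0 :> 'F_7 by apply/eqP.
have -> : 49%:~R = 0 :> 'F_7 by apply/eqP.
by rewrite -nth0 h0 !mul0r !addr0.
Qed.

(** * Rational approximations of the logarithm of 7 *)

Lemma egf_le_weighted_norm (R : realType) k s (z : R) : 0 <= z <= 3 ->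
  `|egf k s z| <= 6 ^+ k * (weighted_norm s)%:~R.
Proof.
move=> /andP[z0 z3]; elim: s k => [|a t IH] k /=; first by rewrite normr0 mulr0.
rewrite (le_trans (ler_normD _ _))// intrD mulrDr lerD//; last first.
  by rewrite intrM mulrA -exprSr.
rewrite normrM intr_norm mulrC ler_wpM2r//.
rewrite ger0_norm ?mulr_ge0 ?invr_ge0 ?exprn_ge0 ?mulr_ge0//.
rewrite ler_pdivrMr ?ltr0n ?fact_gt0// (@le_trans _ _ (6 ^+ k))//.
  by rewrite lerXn2r ?nnegrE ?mulr_ge0//; lra.
by rewrite ler_peMr ?exprn_ge0// ler1n fact_gt0.
Qed.

Lemma fact_le_expn n : (n`! <= n ^ n)%N.
Proof.
suff H k : (k <= n)%N -> (k`! <= n ^ k)%N by exact: H.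
elim: k => // k IH kn; rewrite factS expnS leq_mul// IH//; exact: ltnW.
Qed.

(** The last [2q] factors of [(3q)!] exceed [q]. This lets the [(3q)!] coming from the order of
    vanishing beat the common denominator [q! m^q]. *)
Lemma expn_le_fact q : (q`! * q ^ (2 * q) <= (3 * q)`!)%N.
Proof.
suff H k : (q`! * q ^ k <= (q + k)`!)%N.
  by rewrite (_ : 3 * q = q + 2 * q)%N ?H//; lia.
elim: k => [|k IH]; first by rewrite muln1 addn0.
by rewrite expnSr mulnA addnS factS mulnC leq_mul// -addnS leq_addr.
Qed.

(* The integer [S] is at least 1 in absolute value, while replacing [7^j] by
   [exp(j n/m)] in it gives a form of size less than 1/2. *)
Lemma hermite_gap (R : realType) q k n m : q = (7 ^ k.+1)%N -> (0 < n)%N -> (0 < m)%N ->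
  coprime n m -> (432 * m <= q ^ 2)%N -> 6 <= expR (n%:R / m%:R : R) <= 8 ->
  1 <= 32 * (384 * q%:R * m%:R) ^+ q * `|7 - expR (n%:R / m%:R : R)|.
Proof.
move=> qE n0 m0 co mq; set z := n%:R / m%:R; set E := expR z => /andP[E6 E8].
have z0 : 0 <= z by rewrite /z divr_ge0.
have e2 : 2 <= expR 1 :> R by rewrite (le_trans _ (expR_ge1Dx 1))//; lra.
have z3 : z <= 3.
  rewrite -ler_expR (le_trans E8)// -[3]mulr1 expRM_natl.
  rewrite (@le_trans _ _ (2 ^+ 3))//; first by lra.
  by rewrite lerXn2r ?nnegrE ?expR_ge0.
have z03 : 0 <= z <= 3 by rewrite z0.
have [s1 [s2 [sz1 sz2 [wB fB]]]] := hermite_bound_exists R q.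
have := cleared_form_neq0 qE n0 co sz1 sz2.
set S := _ + _ => S0.
have : 1 <= `|S%:~R : R| by rewrite -intr_norm (@ler_int R 1) -gtz0_ge1 normr_gt0.
set d := `|7 - E|; set w : R := q`!%:R * m%:R ^+ q.
have w0 : 0 <= w by rewrite mulr_ge0 ?exprn_ge0.
have -> : S%:~R = w * (exp_form (hermite0 q) s1 s2 z + egf 0 s1 z * (7 - E) + egf 0 s2 z * (49 - E ^+ 2)).
  rewrite /S !intrD !intrM !(cleared_egfE R) ?size_hermite0 ?sz1 ?sz2// -/z -/w /exp_form.
  rewrite mul0r expR0 mul1r (expRM_natl 2 z) -/E; ring.
have ev1 := egf_le_weighted_norm 0 s1 z03; have ev2 := egf_le_weighted_norm 0 s2 z03.
rewrite normrM ger0_norm// => /le_trans; set A := exp_form _ _ _ _.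
have wB' : (weighted_norm (hermite0 q))%:~R + (weighted_norm s1)%:~R +
    (weighted_norm s2)%:~R <= 384 ^+ q :> R.
  by rewrite -!intrD -(rmorphXn (intmul 1) q 384) ler_int.
have w00 : 0 <= (weighted_norm (hermite0 q))%:~R :> R by rewrite ler0z weighted_norm_ge0.
(* With [z <= 3] and [E <= 8] the left side is at most [64 (8 * 27 m / q^2)^q <= 64 / 2^q], and
   [q >= 7]. *)
have AB : w * `|A| <= 1 / 2.
  have := fB _ z0; rewrite (expRM_natl 2 z) -/E -/A => /(ler_wpM2l w0)/le_trans; apply.
  have f3 : 0 < (3 * q)`!%:R :> R by rewrite ltr0n fact_gt0.
  have q0 : 0 < q%:R :> R by rewrite ltr0n qE expn_gt0.
  have qf : w * (q%:R ^+ 2) ^+ q <= (3 * q)`!%:R * m%:R ^+ q.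
    rewrite /w mulrAC ler_wpM2r ?exprn_ge0// -exprM -natrX -natrM ler_nat.
    exact: expn_le_fact.
  have E2 : E ^+ 2 <= 64 by rewrite (_ : 64 = 8 ^+ 2 :> R) ?lerXn2r ?nnegrE ?expR_ge0//; lra.
  have zq : z ^+ (3 * q) <= 27 ^+ q.
    rewrite exprM lerXn2r ?nnegrE ?exprn_ge0// (_ : 27 = 3 ^+ 3 :> R); last by lra.
    by rewrite lerXn2r ?nnegrE.
  have mq' : 432 * m%:R <= q%:R ^+ 2 :> R by rewrite -natrX -natrM ler_nat.
  have q7 : (7 <= q)%N by rewrite qE expnS leq_pmulr// expn_gt0.
  have p128 : 128 <= 2 ^+ q :> R by rewrite -natrX (ler_nat R 128) (@leq_exp2l 2 7).
  have key : (432 * m%:R) ^+ q <= (q%:R ^+ 2) ^+ q :> R.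
    apply: lerXn2r mq'; rewrite nnegrE; last by rewrite sqr_ge0.
    by rewrite mulr_ge0 ?ler0n.
  rewrite (mulrA w).
  rewrite (@le_trans _ _ (w * (8 ^+ q * (27 ^+ q / (3 * q)`!%:R)) * 64))//.
    rewrite ler_pM ?mulr_ge0 ?exprn_ge0 ?invr_ge0 ?expR_ge0 ?(ltW f3)//.
    by rewrite !ler_wpM2l ?exprn_ge0// ler_wpM2r ?invr_ge0 ?(ltW f3).
  rewrite !mulrA -(mulrA w) -exprMn mulrAC ler_pdivrMr//.
  have Y0 : 0 < (q%:R ^+ 2) ^+ q :> R by rewrite !exprn_gt0.
  rewrite -(ler_pM2r Y0) (_ : 8 * 27 = 216); last by lra.
  have M0 : 0 <= 216 ^+ q * m%:R ^+ q :> R by rewrite mulr_ge0 ?exprn_ge0.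
  move: key; rewrite (_ : 432 * m%:R = 2 * (216 * m%:R) :> R); last by lra.
  rewrite [(2 * _) ^+ q]exprMn [(216 * _) ^+ q]exprMn => key.
  have := ler_wpM2r M0 p128 => /le_trans/(_ key)/(ler_wpM2l (ltW f3)).
  have := ler_wpM2r (exprn_ge0 q (ler0n R 216)) qf.
  clearbody w; move: ((_ ^+ 2) ^+ q) (m%:R ^+ q) (216 ^+ q) ((3 * q)`!%:R) => Y M G F; lra.
have E0 : 0 <= E := expR_ge0 _.
have d49 : `|49 - E ^+ 2| <= 15 * d.
  rewrite (_ : 49 - E ^+ 2 = (7 + E) * (7 - E)); last by ring.
  by rewrite normrM ler_wpM2r// ger0_norm ?addr_ge0//; lra.
have d0 : 0 <= d := normr_ge0 _.
(* The upper bound for [|S|]: [16 = 1 + 15] collects both error terms, and absorbing the 1/2 doubles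
   it to the final 32. *)
move/(_ (w * (16 * 384 ^+ q * d) + 1 / 2)).
have H1 : w * `|A + egf 0 s1 z * (7 - E) + egf 0 s2 z * (49 - E ^+ 2)|
    <= w * (16 * 384 ^+ q * d) + 1 / 2.
  rewrite (le_trans (ler_wpM2l w0 (ler_normD _ _)))//.
  rewrite mulrDr (le_trans (lerD (ler_wpM2l w0 (ler_normD _ _)) (lexx _)))//.
  rewrite mulrDr -addrA addrC lerD// -mulrDr ler_wpM2l// !normrM -/d.
  rewrite (@le_trans _ _ ((weighted_norm s1)%:~R * d + (weighted_norm s2)%:~R * (15 * d)))//.
    rewrite lerD// ?ler_wpM2r//; first by rewrite (le_trans ev1)// expr0 mul1r.
    by rewrite ler_pM// (le_trans ev2)// expr0 mul1r.
  have w1 : 0 <= (weighted_norm s1)%:~R :> R by rewrite ler0z weighted_norm_ge0.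
  have w2 : 0 <= (weighted_norm s2)%:~R :> R by rewrite ler0z weighted_norm_ge0.
  rewrite mulrA -mulrDl ler_wpM2r//.
  by move: wB' w00 w1 w2; move: (384 ^+ q) (_%:~R) (_%:~R) (_%:~R) => a b c e; lra.
move/(_ H1) => H2.
have : 1 <= 2 * (w * (16 * 384 ^+ q * d)).
  by move: H2; move: (w * _) => u; lra.
move=> /le_trans; apply.
rewrite !exprMn (_ : 2 * _ = 32 * (384 ^+ q * w) * d); last by ring.
apply: ler_wpM2r => //; apply: ler_wpM2l; first exact: ler0n.
rewrite -[leRHS]mulrA; apply: ler_wpM2l; first by rewrite exprn_ge0 ?ler0n.
by rewrite /w ler_wpM2r ?exprn_ge0// -natrX ler_nat fact_le_expn.
Qed.

(** For large [q] the bound holds factor by factor: [a q^3 <= (e q)^4 / 24 <= exp(e q)]. The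
    constant [K] covers the finitely many smaller [q]. *)
Lemma expR_dominates (R : realType) (a e : R) : 0 < a -> 0 < e ->
  exists2 K : R, 0 < K & forall q : nat, (a * q%:R ^+ 3) ^+ q <= K * expR (e * q%:R ^+ 2).
Proof.
move=> a0 e0.
have [Q hQ] : exists Q : nat, 24 * a / e ^+ 4 <= Q%:R.
  by exists (Num.bound (24 * a / e ^+ 4)); rewrite ltW// archi_boundP// divr_ge0 ?exprn_ge0 ?mulr_ge0// ltW.
exists ((1 + a * Q%:R ^+ 3) ^+ Q).
  by rewrite exprn_gt0// ltr_wpDr// mulr_ge0 ?exprn_ge0// ltW.
have b0 q : 0 <= a * q%:R ^+ 3 by rewrite mulr_ge0 ?exprn_ge0// ltW.
move=> q; have [qQ|Qq] := leqP q Q.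
  rewrite -[leLHS]mulr1 ler_pM ?exprn_ge0//; last first.
    by rewrite (le_trans _ (expR_ge1Dx _))// lerDl mulr_ge0 ?exprn_ge0// ltW.
  rewrite (@le_trans _ _ ((1 + a * Q%:R ^+ 3) ^+ q))//.
    rewrite lerXn2r ?nnegrE ?addr_ge0//.
    by rewrite ler_wpDl// ler_wpM2l ?(ltW a0)// lerXn2r ?nnegrE// ler_nat.
  by rewrite ler_weXn2l// lerDl.
rewrite -[leLHS]mul1r ler_pM ?exprn_ge0//.
  by rewrite exprn_ege1// lerDl.
rewrite expr2 mulrA expRM_natr lerXn2r ?nnegrE ?expR_ge0//.
rewrite (le_trans _ (expR_ge1Dxn 3 _)) ?mulr_ge0 ?(ltW e0)//.
rewrite ler_wpDl// ler_pdivlMr// exprMn (_ : 4`!%:R = 24)//.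
have : 24 * a / e ^+ 4 <= q%:R by rewrite (le_trans hQ)// ler_nat ltnW.
rewrite ler_pdivrMr ?exprn_gt0// => /(ler_wpM2r (exprn_ge0 3 (ler0n R q))).
by move: (q%:R) (e ^+ 4) => u v; rewrite !exprS expr0; lra.
Qed.

(** * Size of close pairs *)

(* [q] is the power of 7 with [432 m <= q^2 < 49 * 432 m]; then
   [(384 q m)^q = exp(O(sqrt m * ln m))], which is below [exp(m / 20)] up to a constant. *)
Lemma expR_gap (R : realType) : exists2 c : R, 0 < c & forall n m : nat,
  (0 < n)%N -> (0 < m)%N -> 6 <= expR (n%:R / m%:R : R) <= 8 ->
  c * expR (- (m%:R / 20)) <= `|7 - expR (n%:R / m%:R)|.
Proof.
(* The rate is chosen so that [q^2 <= 49 * 432 * m] makes the exponent at most [m / 20]. *)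
have [||K K0 hK] := @expR_dominates R 384 (20 * (49 * 432))^-1; [lra|by rewrite invr_gt0; lra|].
exists (32 * K)^-1; first by rewrite invr_gt0 mulr_gt0.
move=> n m n0 m0; set z := _ / _ => hz.
(* [hermite_gap] wants a reduced fraction; [q] is still chosen from [m], which suffices since
   [m' <= m]. *)
pose g := gcdn n m; have g0 : (0 < g)%N by rewrite gcdn_gt0 n0.
pose n' := (n %/ g)%N; pose m' := (m %/ g)%N.
have nE : n = (n' * g)%N by rewrite divnK// dvdn_gcdl.
have mE : m = (m' * g)%N by rewrite divnK// dvdn_gcdr.
have n'0 : (0 < n')%N by move: n0; rewrite nE muln_gt0 => /andP[].
have m'0 : (0 < m')%N by move: m0; rewrite mE muln_gt0 => /andP[].
have m'm : (m' <= m)%N by rewrite mE leq_pmulr.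
have zE : z = n'%:R / m'%:R.
  rewrite /z nE mE !natrM -mulf_div divff ?mulr1// pnatr_eq0 -lt0n//.
have co : coprime n' m'.
  by rewrite /coprime -(eqn_pmul2r g0) muln_gcdl -nE -mE mul1n.
have /andP[lo hi] := @up_log_bounds 49 (432 * m) isT ltac:(lia).
have := up_log_gt0 49 (432 * m); rewrite [in RHS](_ : (1 < 432 * m)%N); last by lia.
case: (up_log _ _) lo hi => // k lo hi _; rewrite /= in lo.
pose q := (7 ^ k.+1)%N.
have q2 : (q ^ 2)%N = (49 ^ k.+1)%N by rewrite -expnM mulnC expnM.
have q1 : (432 * m <= q ^ 2)%N by rewrite q2.
have q3 : (q ^ 2 <= 49 * (432 * m))%N.
  by rewrite q2 expnS leq_mul2l ltnW.
have mq : (432 * m' <= q ^ 2)%N by rewrite (leq_trans _ q1)// leq_mul2l.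
have := @hermite_gap R q k n' m' erefl n'0 m'0 co mq.
rewrite -zE => /(_ hz); set d := `|_| => H.
have d0 : 0 <= d := normr_ge0 _.
rewrite expRN -invfM -div1r ler_pdivrMr ?mulr_gt0 ?expR_gt0// (le_trans H)//.
rewrite [leLHS]mulrC ler_wpM2l//.
rewrite -[leRHS]mulrA ler_wpM2l//.
have qq : (384 * q%:R * m'%:R) ^+ q <= (384 * q%:R ^+ 3) ^+ q :> R.
  have qm : q%:R * m'%:R <= q%:R ^+ 3 :> R.
    by rewrite exprS ler_wpM2l// -natrX ler_nat; lia.
  rewrite -mulrA; apply: lerXn2r; rewrite ?nnegrE.
  - by rewrite !mulr_ge0 ?ler0n.
  - by rewrite mulr_ge0 ?exprn_ge0 ?ler0n.
  - by apply: ler_wpM2l; first exact: ler0n.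
rewrite (le_trans qq)// (le_trans (hK q))// ler_wpM2l ?(ltW K0)// ler_expR.
rewrite mulrC ler_pdivrMr; last by lra.
have : q%:R ^+ 2 <= 49 * (432 * m%:R) :> R by rewrite -natrX -!natrM ler_nat.
by move: (_ ^+ 2) (m%:R) => x y; lra.
Qed.

(** For [b <= a] this amounts to [b^(m+1) <= b a^m]. *)
Lemma ler_dist_exp (R : realType) (a b : R) m : 0 <= a -> 0 <= b ->
  `|a - b| * Num.max a b ^+ m <= `|a ^+ m.+1 - b ^+ m.+1|.
Proof.
wlog ab : a b / b <= a => [H a0 b0|a0 b0].
  case/orP: (le_total b a) => ab; first exact: H.
  by rewrite distrC maxC [leRHS]distrC H.
rewrite max_l// !ger0_norm ?subr_ge0 ?lerXn2r ?nnegrE//.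
rewrite mulrBl -exprS lerB// exprS ler_wpM2l// lerXn2r ?nnegrE//.
Qed.

Lemma exp_pow_gap (R : realType) : exists2 c : R, 0 < c & forall n m : nat,
  (0 < n)%N -> (0 < m)%N ->
  c * expR (- (m%:R / 20)) * Num.max (7 ^+ m) (expR n%:R) <= `|7 ^+ m - expR n%:R|.
Proof.
have [c c0 hc] := expR_gap R.
(* The 8 bounds [max(7, E)] when [E] lies in [[6, 8]]; outside, [|7 - E|] is at least
   [max(7, E) / 8] anyway, and the minimum with 1 covers this case. *)
exists (Num.min c 1 / 8); first by rewrite divr_gt0// lt_min c0 ltr01.
move=> n m n0 m0; set E := expR (n%:R / m%:R : R).
have -> : expR n%:R = E ^+ m.
  by rewrite /E -expRM_natr divfK// pnatr_eq0 -lt0n.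
have E0 : 0 <= E by exact: expR_ge0.
case: m m0 @E E0 => // m m0 E E0.
have := @ler_dist_exp R 7 E m; move=> /(_ ltac:(lra) E0); apply: le_trans.
have -> : Num.max (7 ^+ m.+1) (E ^+ m.+1) = Num.max 7 E ^+ m.+1.
  case/orP: (le_total 7 E) => h.
    by rewrite !max_r// lerXn2r ?nnegrE.
  by rewrite !max_l// lerXn2r ?nnegrE.
rewrite exprS mulrA ler_wpM2r ?exprn_ge0 ?le_max ?E0 ?orbT//.
have e1 : expR (- (m.+1%:R / 20)) <= 1 :> R by rewrite expR_le1 oppr_le0 divr_ge0.
have e0 : 0 < expR (- (m.+1%:R / 20)) :> R by exact: expR_gt0.
have c1 : Num.min c 1 <= 1 by rewrite ge_min lexx orbT.
have cc : Num.min c 1 <= c by rewrite ge_min lexx.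
have cm0 : 0 < Num.min c 1 by rewrite lt_min c0 ltr01.
have M0 : 0 <= Num.max 7 E by rewrite le_max E0 orbT.
have [hz|nhz] := boolP (6 <= E <= 8).
  apply: le_trans (hc n m.+1 n0 isT hz).
  have M8 : Num.max 7 E <= 8 by rewrite ge_max (andP hz).2 andbT; lra.
  rewrite (@le_trans _ _ (Num.min c 1 / 8 * expR (- (m.+1%:R / 20)) * 8))//.
    by rewrite ler_wpM2l// mulr_ge0 ?divr_ge0// ltW.
  rewrite mulrAC divfK; last by lra.
  by rewrite ler_wpM2r// ltW.
rewrite (@le_trans _ _ (Num.max 7 E / 8))//.
  rewrite [leRHS]mulrC ler_wpM2r// mulrAC -[leRHS]mul1r ler_wpM2r// ?invr_ge0//.
  by rewrite mulr_ile1// ltW.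
move: nhz; rewrite negb_and -!ltNge => /orP[h|h].
  rewrite max_l; last by lra.
  by rewrite ger0_norm; lra.
rewrite max_r; last by lra.
by rewrite distrC ger0_norm; lra.
Qed.

Lemma expR1_ge (R : realType) : 5 / 2 <= expR 1 :> R.
Proof.
rewrite -[X in expR X](_ : 6 * (1 / 6) = 1 :> R); last by lra.
rewrite expRM_natl (@le_trans _ _ ((7 / 6) ^+ 6))//; first by rewrite !exprS expr0; lra.
rewrite lerXn2r ?nnegrE ?expR_ge0//.
by rewrite (le_trans _ (expR_ge1Dx _))//; lra.
Qed.

Lemma expR1_le (R : realType) : expR 1 <= 4 :> R.
Proof.
have h : 1 / 2 <= expR (- (1 / 2)) :> R by rewrite (le_trans _ (expR_ge1Dx _))//; lra.
rewrite -[X in expR X](_ : 2 * (1 / 2) = 1 :> R); last by lra.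
rewrite expRM_natl; move: h; rewrite expRN => h.
have h2 : expR (1 / 2) <= 2 :> R.
  by rewrite -[leLHS]invrK invf_ple ?posrE ?invr_gt0 ?expR_gt0//; lra.
rewrite (_ : 4 = 2 ^+ 2 :> R); last by lra.
by rewrite lerXn2r ?nnegrE ?expR_ge0.
Qed.

(** Compare tenth powers: [5^5 <= (5/2)^9 <= e^9]. *)
Lemma sqrt5_le (R : realType) : Num.sqrt 5 <= expR (9 / 10) :> R.
Proof.
have e0 : 0 <= expR (9 / 10) :> R by exact: expR_ge0.
rewrite -(@ler_pXn2r _ 10)// ?nnegrE ?sqrtr_ge0//.
rewrite -expRM_natl (_ : 10 * (9 / 10) = 9 * 1 :> R); last by lra.
rewrite expRM_natl (@le_trans _ _ ((5 / 2) ^+ 9))//.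
  rewrite -[10%N]/(2 * 5)%N exprM sqr_sqrtr// !exprS expr0; lra.
by rewrite lerXn2r ?nnegrE ?expR_ge0 ?expR1_ge.
Qed.

Lemma pi_le_7 (R : realType) : pi <= expR (9 / 10 * ln 7) :> R.
Proof.
have e0 : 0 <= expR (9 / 10 * ln 7) :> R by exact: expR_ge0.
rewrite (@le_trans _ _ 4)//; first by have := pihalf_lt2 R; lra.
rewrite -(@ler_pXn2r _ 10)// ?nnegrE//.
rewrite -expRM_natl (_ : 10 * _ = 9 * ln 7 :> R); last by lra.
rewrite expRM_natl lnK ?posrE; last by lra.
rewrite !exprS expr0; lra.
Qed.

Lemma ln7_ge1 (R : realType) : 1 <= ln 7 :> R.
Proof. by rewrite -ler_expR lnK ?posrE//; have := expR1_le R; lra. Qed.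

(* With [y^20 = max(7^m, e^n)], the main difference is at least [c y^19] while
   both secondary terms are at most [y^18]. *)
Lemma close_pairs_log_bound (R : realType) : exists K : R, forall x : R, 1 <= x ->
  forall n m, close_pairs x (n, m) -> n%:R <= 20 * ln x + K /\ m%:R <= 20 * ln x + K.
Proof.
have [c c0 hc] := exp_pow_gap R.
exists (20 * ln (4 / c)) => x x1 n m [/= n0 m0].
have c4 : 0 < 4 / c by rewrite divr_gt0.
have l7 := ln7_ge1 R.
have e7 : expR (ln 7) = 7 :> R by rewrite lnK// posrE.
pose L : R := Num.max n%:R (m%:R * ln 7); set y := expR (L / 20).
have nL : n%:R <= L by rewrite le_max lexx.
have mL : m%:R * ln 7 <= L by rewrite le_max lexx orbT.
have mL' : m%:R <= L by rewrite (le_trans _ mL)// ler_peMr.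
have L0 : 0 <= L by rewrite (le_trans _ nL).
have y1 : 1 <= y by rewrite (le_trans _ (expR_ge1Dx _))// lerDl divr_ge0.
have yE k : y ^+ k = expR (k%:R / 20 * L).
  by rewrite /y -expRM_natl; congr expR; ring.
have M : Num.max (7 ^+ m) (expR n%:R) = y ^+ 20.
  rewrite yE divff// mul1r -[in 7 ^+ m]e7 -expRM_natl maxC /L.
  case/orP: (le_total n%:R (m%:R * ln 7 : R)) => h.
    by rewrite !max_r// ler_expR.
  by rewrite !max_l// ler_expR.
rewrite -(expRM_natl n 1) mulr1.
have s0 : 0 <= Num.sqrt 5 ^+ n :> R by rewrite exprn_ge0// sqrtr_ge0.
have p0 : 0 <= pi ^+ m :> R by rewrite exprn_ge0// pi_ge0.
have s1 : Num.sqrt 5 ^+ n <= y ^+ 18.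
  rewrite (@le_trans _ _ (expR (9 / 10) ^+ n))//.
    by rewrite lerXn2r ?nnegrE ?sqrtr_ge0 ?expR_ge0 ?sqrt5_le.
  by rewrite -expRM_natl yE ler_expR; lra.
have p1 : pi ^+ m <= y ^+ 18.
  rewrite (@le_trans _ _ (expR (9 / 10 * ln 7) ^+ m))//.
    by rewrite lerXn2r ?nnegrE ?pi_ge0 ?expR_ge0 ?pi_le_7.
  by rewrite -expRM_natl yE ler_expR; lra.
move=> close.
have := hc n m n0 m0; rewrite M => H.
have {}H : c * y ^+ 19 <= x + 2 * y ^+ 18.
  rewrite (@le_trans _ _ (c * expR (- (m%:R / 20)) * y ^+ 20))//.
    rewrite -mulrA ler_wpM2l ?(ltW c0)// !yE -expRD ler_expR.
    by lra.
  rewrite (le_trans H)// ler_norml; move: close; rewrite ler_norml => /andP[h1 h2].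
  by apply/andP; split; lra.
have y19 : y <= y ^+ 19 by rewrite -[leLHS]expr1 ler_weXn2l.
have yx : y <= 4 / c * x.
  rewrite mulrAC ler_pdivlMr//.
  (* If [y c > 4], then [2 y^18] is at most half of [c y^19] and is absorbed on the left; otherwise
     [y] is bounded outright. *)
  have [h|h] := lerP (y * c) 4.
    by rewrite (le_trans h)// ler_peMr.
  have : 4 * y ^+ 18 <= c * y ^+ 19.
    by rewrite [y ^+ 19]exprS mulrA ler_wpM2r ?exprn_ge0//; lra.
  have : y * c <= y ^+ 19 * c by rewrite ler_wpM2r// ltW.
  by move: (y ^+ 19) (y ^+ 18) H => u v H; lra.
have : L <= 20 * ln x + 20 * ln (4 / c).
  rewrite -mulrDr [_ + _]addrC -lnM ?posrE//; last by lra.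
  rewrite -ler_pdivrMl// mulrC -ler_expR lnK// posrE mulr_gt0//; lra.
by split; lra.
Qed.

(** * Counting close pairs *)

Lemma finite_close_pairs (R : realType) (x : R) : finite_set (close_pairs x).
Proof.
have [K hK] := close_pairs_log_bound R.
(* The logarithmic bound asks for [x >= 1]; enlarging [x] only adds pairs. *)
pose y := Num.max x 1; pose N := (Num.truncn (20 * ln y + K)).+1.
apply: (@sub_finite_set _ _ (`I_N `*` `I_N)); last exact: finite_setX.
move=> [n m] [n0 m0 h].
have [||hn hm] := hK y _ n m; first by rewrite le_max lexx orbT.
  by split=> //; rewrite (le_trans h)// le_max lexx.
have nn k : k%:R <= 20 * ln y + K -> (k < N)%N.
  by move=> hk; rewrite ltnS truncn_ge_nat// (le_trans _ hk).
by split; exact: nn.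
Qed.

(** For [n < n'] the doubling gives [2 (7^m + pi^m - x) <= 7^m + pi^m + x], so [7^m <= 3 x]. *)
Lemma close_pair_uniq (R : realType) (x : R) n n' m : 4 * x < 7 ^+ m ->
  close_pairs x (n, m) -> close_pairs x (n', m) -> n = n'.
Proof.
move=> xm; wlog nn' : n n' / (n < n')%N => [H h h'|].
  have [lt|lt|->//] := ltngtP n n'; first exact: H.
  by apply/esym; exact: H.
move=> [/= _ _ h1] [/= _ _ h2]; exfalso.
have p0 : 0 <= pi ^+ m :> R by rewrite exprn_ge0// pi_ge0.
have s2 : 2 <= Num.sqrt 5 :> R.
  by rewrite -(@ler_pXn2r _ 2)// ?nnegrE ?sqrtr_ge0// sqr_sqrtr// expr2; lra.
have s0 : 0 <= Num.sqrt 5 ^+ n :> R by rewrite exprn_ge0// sqrtr_ge0.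
have e0 : 0 <= expR 1 ^+ n :> R by rewrite exprn_ge0// expR_ge0.
have e2 : 2 <= expR 1 :> R by have := expR1_ge R; lra.
have grow (a : R) : 2 <= a -> 2 * a ^+ n <= a ^+ n'.
  move=> a2; have a0 : 0 <= a by lra.
  rewrite (@le_trans _ _ (a ^+ n.+1))//; last by rewrite ler_weXn2l//; lra.
  by rewrite exprS ler_wpM2r ?exprn_ge0.
have := grow _ s2; have := grow _ e2.
move: h1 h2 xm p0 s0 e0; rewrite !ler_norml => /andP[h1 h2] /andP[h3 h4].
move: (expR 1 ^+ n) (expR 1 ^+ n') (Num.sqrt 5 ^+ n) (Num.sqrt 5 ^+ n') (7 ^+ m) (pi ^+ m) h1 h2 h3 h4.
by move=> a a' b b' c d *; lra.
Qed.

Lemma T_upper (R : realType) : exists C : R, forall x : R, 1 <= ln x ->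
  (T x)%:R <= ln x ^+ 2 / ln 7 + C * ln x.
Proof.
have [K hK] := close_pairs_log_bound R.
exists (ln 9 + ln 4 + ln 9 * ln 4 + 20 + `|K|) => x l1.
have x0 : 0 < x by rewrite ltNge; apply/negP => /ln0 h; move: l1; rewrite h; lra.
have x1 : 1 <= x by rewrite leNgt; apply/negP => h; have := ln_lt0 (x := x); rewrite x0 h => /(_ isT); lra.
have l7 := ln7_ge1 R.
have l9 : 0 <= ln 9 :> R by apply: ln_ge0; lra.
have l4 : 0 <= ln 4 :> R by apply: ln_ge0; lra.
(* The sides of the box: if [7^m <= 4 x], then [e^n <= x + 7^m + pi^m <= 9 x]. *)
pose A := ln x + ln 9; pose B := (ln x + ln 4) / ln 7; pose D := 20 * ln x + K.
pose E := enum_fset (fset_set (close_pairs x)).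
have memE p : p \in E -> close_pairs x p.
  by move=> pE; have : p \in fset_set (close_pairs x) := pE;
    rewrite in_fset_set ?inE//; exact: finite_close_pairs.
pose small (p : nat * nat) := 7 ^+ p.2 <= 4 * x.
have szE : T x = (size [seq p <- E | small p] + size [seq p <- E | predC small p])%N.
  by rewrite !size_filter count_predC.
have A0 : 0 <= A by rewrite /A; lra.
have B0 : 0 <= B by rewrite /B divr_ge0//; lra.
have box : (size [seq p <- E | small p] <= Num.truncn A * Num.truncn B)%N.
  rewrite -{1}(size_iota 1 (Num.truncn A)) -{1}(size_iota 1 (Num.truncn B)) -(size_allpairs pair).
  apply: uniq_leq_size; first by rewrite filter_uniq// fset_uniq.
  move=> [n m]; rewrite mem_filter => /andP[sm /memE[/= n0 m0 h]].
  rewrite /small /= in sm.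
  apply/allpairsP; exists (n, m) => /=; split => //; rewrite mem_iota ?n0 ?m0 add1n ltnS truncn_ge_nat//.
    rewrite /A -lnM ?posrE// -ler_expR lnK ?posrE ?mulr_gt0// -[n%:R]mulr1 expRM_natl.
    have s0 : 0 <= Num.sqrt 5 ^+ n :> R by rewrite exprn_ge0// sqrtr_ge0.
    have : pi ^+ m <= 7 ^+ m :> R.
      by rewrite lerXn2r ?nnegrE ?pi_ge0//; have := pihalf_lt2 R; lra.
    by move: h; rewrite ler_norml => /andP[h1 h2]; lra.
  rewrite /B ler_pdivlMr ?(lt_le_trans ltr01)// -lnM ?posrE// -ler_expR lnK ?posrE ?mulr_gt0//.
  by rewrite expRM_natl lnK ?posrE// mulrC.
(* On the tail [m] determines [n], so it is enough to count the values of [m]. *)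
have tail : (size [seq p <- E | predC small p])%:R <= 20 * ln x + `|K|.
  have D0 : 0 <= 20 * ln x + `|K| by rewrite addr_ge0//; lra.
  have := D0; rewrite -truncn_le; apply: le_trans; rewrite ler_nat.
  rewrite -(size_map snd) -[leqRHS](size_iota 1).
  apply: uniq_leq_size.
    rewrite map_inj_in_uniq; first by rewrite filter_uniq// fset_uniq.
    move=> [n m] [n' m']; rewrite !mem_filter => /andP[/= sm /memE h] /andP[_ /memE h'] mm.
    rewrite -{}mm in h' *; congr (_, _).
    by apply: close_pair_uniq h h'; rewrite ltNge.
  move=> _ /mapP[[n m] + ->]; rewrite mem_filter => /andP[_ /memE h] /=.
  have [_ hm] := hK x x1 n m h; case: h => /= _ m0 _.
  by rewrite mem_iota m0 add1n ltnS truncn_ge_nat// (le_trans hm)// lerD2l ler_norm.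
have box' : (size [seq p <- E | small p])%:R <= A * B.
  rewrite (@le_trans _ _ (Num.truncn A * Num.truncn B)%:R) ?ler_nat//.
  by rewrite natrM ler_pM// truncn_le.
rewrite szE natrD (le_trans (lerD box' tail))//.
have -> : A * B = ln x ^+ 2 / ln 7 + (ln x * (ln 9 + ln 4) + ln 9 * ln 4) / ln 7.
  by rewrite /A /B; field; rewrite gt_eqF// (lt_le_trans ltr01).
have i7 : (ln 7)^-1 <= 1 :> R by rewrite invf_le1// (lt_le_trans ltr01).
rewrite -addrA lerD2l.
have Q0 : 0 <= ln x * (ln 9 + ln 4) + ln 9 * ln 4.
  by rewrite addr_ge0 ?mulr_ge0 ?addr_ge0//; lra.
rewrite (@le_trans _ _ ((ln x * (ln 9 + ln 4) + ln 9 * ln 4) + (20 * ln x + `|K|)))//.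
  by rewrite lerD2r -[leRHS]mulr1 ler_wpM2l.
have := ler_wpM2l (mulr_ge0 l9 l4) l1.
have := ler_wpM2l (normr_ge0 K) l1.
by move: (ln 9) (ln 4) (ln x) `|K| => a b c d; lra.
Qed.

Lemma T_lower (R : realType) (x : R) : 1 + ln 7 <= ln x ->
  ln x ^+ 2 / ln 7 - 4 * ln x <= (T x)%:R.
Proof.
move=> l1; have l7 := ln7_ge1 R.
have l70 : 0 < ln 7 :> R by lra.
have x0 : 0 < x by rewrite ltNge; apply/negP => /ln0 h; move: l1; rewrite h; lra.
(* If [e^n] and [7^m] are at most [x / 2], then [e^n + sqrt 5 ^ n] and [7^m + pi^m] both lie in
   [[0, x]], so they differ by at most [x]. *)
pose u := ln (x / 2); have x20 : 0 < x / 2 by rewrite divr_gt0.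
have ul : u <= ln x by rewrite ler_ln ?posrE//; lra.
have lu : ln x - 1 <= u.
  rewrite /u ln_div ?posrE// lerD2l lerN2 -ler_expR lnK ?posrE//.
  by have := expR1_ge R; lra.
pose N := Num.truncn u; pose M := Num.truncn (u / ln 7).
have u0 : 0 <= u by lra.
have u70 : 0 <= u / ln 7 by rewrite divr_ge0// ltW.
have NM : (N * M <= T x)%N.
  rewrite -(size_iota 1 N) -{1}(size_iota 1 M) -(size_allpairs pair).
  apply: uniq_leq_size.
    by apply: allpairs_uniq; rewrite ?iota_uniq// => -[? ?] [? ?].
  move=> p /allpairsP[[n m] /= [+ + ->]]; rewrite !mem_iota !add1n !ltnS.
  move=> /andP[n0 nN] /andP[m0 mM].
  suff : (n, m) \in fset_set (close_pairs x) by [].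
  rewrite in_fset_set ?inE; last exact: finite_close_pairs.
  split => //=.
  move: nN; rewrite truncn_ge_nat// -ler_expR lnK ?posrE// -[n%:R]mulr1 expRM_natl => en.
  move: mM; rewrite truncn_ge_nat// ler_pdivlMr// -ler_expR expRM_natl !lnK ?posrE// => em.
  have s0 : 0 <= Num.sqrt 5 ^+ n :> R by rewrite exprn_ge0// sqrtr_ge0.
  have p0 : 0 <= pi ^+ m :> R by rewrite exprn_ge0// pi_ge0.
  have e0 : 0 <= expR 1 ^+ n :> R by rewrite exprn_ge0// expR_ge0.
  have q0 : 0 <= 7 ^+ m :> R by rewrite exprn_ge0.
  have pm : pi ^+ m <= 7 ^+ m :> R.
    by rewrite lerXn2r ?nnegrE ?pi_ge0//; have := pihalf_lt2 R; lra.
  have sn : Num.sqrt 5 ^+ n <= expR 1 ^+ n :> R.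
    rewrite lerXn2r ?nnegrE ?expR_ge0 ?sqrtr_ge0// (le_trans (sqrt5_le R))//.
    by rewrite ler_expR; lra.
  by rewrite ler_norml; apply/andP; split; lra.
have hN : u - 1 <= N%:R.
  by rewrite lerBlDr natr1 ltW// real_truncnS_gt// num_real.
have hM : u / ln 7 - 1 <= M%:R.
  by rewrite lerBlDr natr1 ltW// real_truncnS_gt// num_real.
rewrite (@le_trans _ _ (N * M)%:R) ?ler_nat// natrM.
(* The hypothesis gives [u >= ln x - 1 >= ln 7], so both lower bounds are nonnegative and may be
   multiplied. *)
have h1 : 0 <= u - 1 by lra.
have h2 : 0 <= u / ln 7 - 1 by rewrite subr_ge0 ler_pdivlMr// mul1r; lra.
apply: le_trans (ler_pM h1 h2 hN hM).
have -> : (u - 1) * (u / ln 7 - 1) = (u ^+ 2 - u) / ln 7 - u + 1 by field; rewrite gt_eqF.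
have sq : (ln x - 1) ^+ 2 <= u ^+ 2 by rewrite lerXn2r ?nnegrE//; lra.
have : ln x ^+ 2 / ln 7 - 3 * ln x <= (u ^+ 2 - u) / ln 7.
  rewrite lerBlDr -[X in _ <= _ + X](@mulfK _ (ln 7)) ?gt_eqF// -mulrDl ler_pM2r ?invr_gt0//.
  have : ln x * 1 <= ln x * ln 7 by rewrite ler_wpM2l//; lra.
  move: sq; rewrite sqrrB1 => sq hh.
  rewrite (_ : 3 * ln x * ln 7 = 3 * (ln x * ln 7)); last by ring.
  by move: (ln x ^+ 2) (u ^+ 2) (ln x * ln 7) sq hh => a b c; lra.
by lra.
Qed.

Theorem theorem4 (R : realType) :
  (forall x : R, finite_set (close_pairs x)) /\
  exists f g : R -> R,
    [/\ f =O_ (+oo_R) (fun x => ln x),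
        g =O_ (+oo_R) (fun x => ln x * ln (ln x)) &
        \forall x \near +oo_R,
          ln x ^+ 2 / ln 7 + f x <= (T x)%:R <= ln x ^+ 2 / ln 7 + g x].
Proof.
split; first exact: finite_close_pairs.
have [C hC] := T_upper R.
(* The second error term is [O(ln x * ln (ln x))] because [ln (ln x) >= 1] eventually. *)
exists (fun x => - (4 * ln x)), (fun x => C * ln x).
have ln_large (a : R) : \forall x \near +oo_R, a <= ln x.
  near=> x; have : expR a <= x by near: x; exact: nbhs_pinfty_ge.
  by move=> ax; rewrite -ler_expR lnK// posrE (lt_le_trans (expR_gt0 a)).
split.
- apply/eqO_exP; exists 4 => //; near=> x.
  by rewrite normrN normrM ger0_norm.
- apply/eqO_exP; exists (`|C| + 1); first by rewrite ltr_wpDl.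
  near=> x; rewrite !normrM.
  have l : expR 1 <= ln x by near: x; exact: ln_large.
  have ll : 1 <= ln (ln x) by rewrite -ler_expR lnK// posrE (lt_le_trans (expR_gt0 1)).
  rewrite ler_pM// ?lerDl// ler_peMr//.
  by rewrite (le_trans ll)// ler_norm.
- near=> x; apply/andP; split.
    by apply: T_lower; near: x; exact: ln_large.
  by apply: hC; near: x; exact: ln_large.
Unshelve. all: by end_near.
Qed.
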